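(* For every even integer $m \ge 6$ the chromatic number of $H_m$ is $3$, and for every odd integer $m \ge 5$ the chromatic number of $G_m$ is $4$.
   Context: All graphs are finite and simple. Let $m \ge 5$ be an integer and $n = 2m+1$. The graph $G_m$ is defined for $m$ odd and the graph $H_m$ for $m$ even. In both cases the vertex set consists of the $n$ distinct vertices $a_n$, $p_1,\dots,p_m$, $q_1,\dots,q_m$. All indices of $p$ and $q$ are taken modulo $m$ with representatives in $\{1,\dots,m\}$ (so $q_0 = q_m$, $p_{m+1}=p_1$, $q_{m+1} = q_1$, etc.). The (undirected) edges are: (1) $a_n q_i$ for $1 \le i \le m$; (2) $p_i p_{i+1}$ for $1 \le i \le m$; (3) for $G_m$ ($m$ odd): $p_i q_{i+(2k-1)}$ for $1 \le i \le m$ and all integers $k$ with $0 \le k \le \frac{m-3}{2}$; for $H_m$ ($m$ even): $p_i q_{i+(2k-1)}$ for $1 \le i \le m$ and all integers $k$ with $0 \le k \le \frac{m-2}{2}$. There are no other edges. *)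

(* Defs.v *)
From mathcomp Require Import all_boot.

Set Implicit Arguments.
Unset Strict Implicit.
Unset Printing Implicit Defensive.

Record sgraph := SGraph {
  svertex :> finType;
  sedge : rel svertex;
  sedge_sym : symmetric sedge;
  sedge_irrefl : irreflexive sedge }.

Definition proper_coloring (G : sgraph) (k : nat) (f : G -> 'I_k) : bool :=
  [forall x, forall y, sedge x y ==> (f x != f y)].

Definition colorable (G : sgraph) (k : nat) : bool :=
  [exists f : {ffun G -> 'I_k}, proper_coloring f].

Lemma colorable_card (G : sgraph) : exists k, colorable G k.
Proof.
exists #|G|; apply/existsP; exists [ffun x => enum_rank x].
apply/forallP => x; apply/forallP => y; apply/implyP => exy.
rewrite !ffunE (inj_eq enum_rank_inj).
by apply: contraTneq exy => ->; rewrite sedge_irrefl.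
Qed.

Definition chromatic_number (G : sgraph) : nat := ex_minn (colorable_card G).

(* a_n, p_i and q_i are None, Some (inl i) and Some (inr i).
   The index i of p and q is the residue class of i : 'I_m modulo m, so the
   ordinal 0 stands for the index m. *)
Definition GH_vertex (m : nat) : finType := option ('I_m + 'I_m)%type.

(* The congruence j = i + (2k - 1) is written j + 1 = i + 2k, since k = 0 is
   allowed and subtraction on nat is truncated. *)
Definition GH_arc (m K : nat) (x y : GH_vertex m) : bool :=
  match x, y with
  | None, Some (inr _) => true
  | Some (inl i), Some (inl j) => j == i + 1 %[mod m]
  | Some (inl i), Some (inr j) =>
      [exists k : 'I_K.+1, j + 1 == i + 2 * k %[mod m]]
  | _, _ => false
  end.

Definition GH_edge (m K : nat) : rel (GH_vertex m) :=
  fun x y => (x != y) && (GH_arc K x y || GH_arc K y x).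

Lemma GH_edge_sym (m K : nat) : symmetric (@GH_edge m K).
Proof. by move=> x y; rewrite /GH_edge eq_sym orbC. Qed.

Lemma GH_edge_irrefl (m K : nat) : irreflexive (@GH_edge m K).
Proof. by move=> x; rewrite /GH_edge eqxx. Qed.

Definition GH_graph (m K : nat) : sgraph :=
  SGraph (@GH_edge_sym m K) (@GH_edge_irrefl m K).

(* Intended for odd m >= 5; k ranges over 0 <= k <= (m - 3) / 2. *)
Definition G_graph (m : nat) : sgraph := GH_graph m (m - 3)./2.

(* Intended for even m >= 6; k ranges over 0 <= k <= (m - 2) / 2. *)
Definition H_graph (m : nat) : sgraph := GH_graph m (m - 2)./2.

(* Main.v *)
Require Import Defs.
From mathcomp Require Import all_boot.
From mathcomp Require Import zmodp zify.

Set Implicit Arguments.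
Unset Strict Implicit.
Unset Printing Implicit Defensive.

(** Upper bounds are explicit colorings.  For m even, p_i is adjacent to q_j
    only if i and j have opposite parities, so coloring both p_i and q_i by the
    parity of i, and a_n by a third color, is proper (lemma
    [colorable3_even]).  In general the cycle of the p_i takes three colors,
    the q_i are pairwise nonadjacent and all take a fourth one, and a_n reuses
    a color of the cycle (lemma [colorable4]).

    For the lower bounds, a_n, q_0, p_1, p_2, q_1 form a 5-cycle, hence two
    colors never suffice (lemma [not_colorable2]).  When k = 0 and k = 1 are
    both allowed, q_i is adjacent to p_{i-1} and p_{i+1}, so the graph contains
    the Mycielski graph of the cycle C_m, and Mycielski's argument applies
    (lemma [not_colorable3_odd]): in a 3-coloring, replace the color of each p_i
    that is colored as a_n by the color of its twin q_i.  The cycle remains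
    properly colored and avoids the color of a_n, so it is 2-colored, which
    forces m to be even. *)

(** Colors are compared as natural numbers, which makes statements about few
    colors linear arithmetic. *)
Lemma colorableP (G : sgraph) (k : nat) :
  reflect (exists2 c : G -> nat, forall x, c x < k &
             forall x y, sedge x y -> c x != c y)
          (colorable G k).
Proof.
apply: (iffP existsP) => [[f /forallP f_proper] | [c c_lt c_proper]].
  exists (fun x => nat_of_ord (f x)) => [x | x y xy]; first exact: ltn_ord.
  by have /forallP/(_ y)/implyP/(_ xy) := f_proper x.
exists [ffun x => Ordinal (c_lt x)].
apply/forallP => x; apply/forallP => y; apply/implyP => xy.
by rewrite !ffunE -val_eqE c_proper.
Qed.

Lemma colorable_leq (G : sgraph) (k l : nat) :
  k <= l -> colorable G k -> colorable G l.
Proof.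
move=> le_kl /colorableP[c c_lt c_proper]; apply/colorableP.
by exists c => // x; apply: leq_trans le_kl.
Qed.

Lemma chromatic_numberS (G : sgraph) (k : nat) :
  colorable G k.+1 -> ~~ colorable G k -> chromatic_number G = k.+1.
Proof.
move=> colS ncol; rewrite /chromatic_number; case: ex_minnP => l col_l min_l.
apply/eqP; rewrite eqn_leq min_l //= ltnNge.
by apply: contra ncol => /colorable_leq; apply.
Qed.

Lemma alternating_odd (g : nat -> bool) :
  (forall i, g i.+1 = ~~ g i) -> forall i, g i = odd i (+) g 0.
Proof. by move=> gS; elim=> //= i IHi; rewrite gS IHi addNb. Qed.

(** It suffices to look at each edge in one direction, and the relation
    defining the arcs leaves only three kinds of them. *)
Lemma GH_colorable (m K k : nat) (a : nat) (cp cq : 'I_m -> nat) :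
    a < k -> (forall i, cp i < k) -> (forall j, cq j < k) ->
    (forall j, a != cq j) ->
    (forall i j : 'I_m, i != j -> j = i + 1 %[mod m] -> cp i != cp j) ->
    (forall (i j : 'I_m) (l : 'I_K.+1),
       j + 1 = i + 2 * l %[mod m] -> cp i != cq j) ->
  colorable (GH_graph m K) k.
Proof.
move=> a_lt cp_lt cq_lt a_cq cp_cp cp_cq; apply/colorableP.
pose c (x : GH_vertex m) :=
  match x with
  | None => a
  | Some (inl i) => cp i
  | Some (inr j) => cq j
  end.
have c_arc x y : x != y -> GH_arc K x y -> c x != c y.
  case: x y => [[i|i]|] [[j|j]|] //=.
    by move=> ij /eqP; apply: cp_cp; apply: contra ij => /eqP->.
  by move=> _ /existsP[l /eqP]; apply: cp_cq.
exists c => [[[i|j]|] /= | x y /andP[neq_xy /orP[xy|yx]]] //.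
  exact: c_arc xy.
by rewrite eq_sym; apply: c_arc yx; rewrite eq_sym.
Qed.

(** Vertices indexed by natural numbers read modulo m = n.+1, so that walks
    around the cycle need no wrap-around cases. *)
Definition pv (n i : nat) : GH_vertex n.+1 := Some (inl (inZp i)).
Definition qv (n j : nat) : GH_vertex n.+1 := Some (inr (inZp j)).

Lemma edge_aq (n K j : nat) : GH_edge K None (qv n j).
Proof. by []. Qed.

Lemma edge_pp (n K i : nat) : 0 < n -> GH_edge K (pv n i) (pv n i.+1).
Proof.
move=> n_gt0; rewrite /GH_edge; apply/andP; split.
  apply/eqP => -[] /eqP; rewrite -[i.+1]addn1 -{1}[i]addn0 eqn_modDl.
  by rewrite mod0n modn_small.
by rewrite /= modn_mod modnDml addn1 eqxx.
Qed.

Lemma edge_pq (n K i j l : nat) : l <= K ->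
  j.+1 = i + 2 * l %[mod n.+1] -> GH_edge K (pv n i) (qv n j).
Proof.
move=> le_lK eq_ij; rewrite /GH_edge; apply/andP; split=> //.
apply/orP; left; apply/existsP; exists (Ordinal (le_lK : l < K.+1)).
by rewrite /= !modnDml addn1; apply/eqP.
Qed.

Lemma pv_period (n : nat) : pv n n.+1 = pv n 0.
Proof. by congr (Some (inl _)); apply: val_inj; rewrite /= modnn mod0n. Qed.

Lemma qv_period (n : nat) : qv n n.+1 = qv n 0.
Proof. by congr (Some (inr _)); apply: val_inj; rewrite /= modnn mod0n. Qed.

(** As m is even, reduction modulo m preserves parity, hence every edge p_i q_j
    and every edge of the cycle joins indices of opposite parities. *)
Lemma colorable3_even (m K : nat) : ~~ odd m -> colorable (GH_graph m K) 3.
Proof.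
move=> /negbTE m_even.
have odd_eqm x y : x = y %[mod m] -> odd x = odd y.
  by move=> /(congr1 odd); rewrite !odd_mod.
apply: (@GH_colorable _ _ _ 2 (fun i => odd i) (fun j => odd j)) => //.
- by move=> i; case: odd.
- by move=> j; case: odd.
- by move=> j; case: odd.
- by move=> i j _ /odd_eqm; rewrite addn1 /= => ->; case: odd.
move=> i j l /odd_eqm; rewrite addn1 mul2n oddD odd_double addbF /= => <-.
by case: odd.
Qed.

(** The colors along the cycle alternate between 0 and 1, except that the last
    vertex gets 2. *)
Lemma colorable4 (m K : nat) : colorable (GH_graph m K) 4.
Proof.
pose cp (i : 'I_m) : nat := if i.+1 == m then 2 else odd i.
have cp_lt3 i : cp i < 3 by rewrite /cp; case: ifP => // _; case: odd.
apply: (@GH_colorable _ _ _ 0 cp (fun=> 3)) => //.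
- by move=> i; apply: ltnW; apply: cp_lt3.
- move=> i j neq_ij; rewrite addn1 modn_small // /cp => eq_ji.
  have [im|im] := eqVneq i.+1 m.
    have [jm|_] := eqVneq j.+1 m; last by case: odd.
    by case/eqP: neq_ij; apply: val_inj; apply: succn_inj; rewrite im jm.
  move: eq_ji; rewrite modn_small => [->|]; last by rewrite ltn_neqAle im /=.
  by case: ifP => _ /=; case: odd.
by move=> i j l _; rewrite neq_ltn cp_lt3.
Qed.

(** The 5-cycle a_n, q_0, p_1, p_2, q_1 uses only the offset k = 0, so it is
    present whatever the bound on k and the parity of m. *)
Lemma not_colorable2 (m K : nat) : 1 < m -> ~~ colorable (GH_graph m K) 2.
Proof.
case: m => // n n_gt0; apply/negP => /colorableP[c c_lt c_proper].
have aq0 := c_proper _ _ (edge_aq n K 0).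
have aq1 := c_proper _ _ (edge_aq n K 1).
have p1p2 := c_proper _ _ (edge_pp K 1 n_gt0).
have p1q0 : c (pv n 1) != c (qv n 0).
  by apply: c_proper; apply: (@edge_pq _ _ _ _ 0).
have p2q1 : c (pv n 2) != c (qv n 1).
  by apply: c_proper; apply: (@edge_pq _ _ _ _ 0).
have := (c_lt None, c_lt (pv n 1), c_lt (pv n 2), c_lt (qv n 0), c_lt (qv n 1)).
by case=> [[[[]]]]; lia.
Qed.

(** Mycielski's argument: [f] recolors the cycle with the two colors other than
    that of a_n, which an odd cycle does not admit. *)
Lemma not_colorable3_odd (m K : nat) :
  1 < m -> 0 < K -> odd m -> ~~ colorable (GH_graph m K) 3.
Proof.
case: m => // n n_gt0 K_gt0 m_odd; apply/negP => /colorableP[c c_lt c_proper].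
pose a := c None.
pose f i := if c (pv n i) == a then c (qv n i) else c (pv n i).
have f_lt i : f i < 3 by rewrite /f; case: ifP.
have f_a i : f i != a.
  rewrite /f; case: ifP => [_|/negbT //].
  by rewrite eq_sym; apply: c_proper; apply: edge_aq.
have f_S i : f i != f i.+1.
  have pp := c_proper _ _ (edge_pp K i n_gt0).
  (* The twin q_{i+1} is a neighbor of p_i by l = 1, and q_i one of p_{i+1} by
     l = 0. *)
  have pq : c (pv n i) != c (qv n i.+1).
    by apply: c_proper; apply: (@edge_pq _ _ _ _ 1) => //; rewrite addn2.
  have qp : c (pv n i.+1) != c (qv n i).
    by apply: c_proper; apply: (@edge_pq _ _ _ _ 0) => //; rewrite addn0.
  rewrite /f; case: ifP => [/eqP pi_a|_]; case: ifP => [/eqP pi1_a|_] //.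
    by rewrite pi_a pi1_a eqxx in pp.
  by rewrite eq_sym.
(* Two colors are left, so being colored as p_0 alternates along the cycle. *)
have g_S i : (f i.+1 == f 0) = ~~ (f i == f 0).
  have := (f_lt i, f_lt i.+1, f_lt 0, c_lt None : a < 3).
  have := (f_a i, f_a i.+1, f_a 0, f_S i).
  by case=> [[[? ?] ?] ?] [[[? ?] ?] ?]; lia.
have := alternating_odd g_S n.+1.
by rewrite /f pv_period qv_period m_odd eqxx.
Qed.

Theorem lemma4p1 :
  (forall m : nat, 6 <= m -> ~~ odd m -> chromatic_number (H_graph m) = 3) /\
  (forall m : nat, 5 <= m -> odd m -> chromatic_number (G_graph m) = 4).
Proof.
split=> m m_ge m_parity; apply: chromatic_numberS.
- exact: colorable3_even.
- by apply: not_colorable2; apply: leq_trans m_ge.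
- exact: colorable4.
apply: not_colorable3_odd => //; first exact: leq_trans m_ge.
by rewrite half_gt0 leq_subRL ?(leq_trans _ m_ge).
Qed.
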